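(* Consider an $n$-qubit quantum circuit with initial state $(|0\rangle\langle 0|)^{\otimes n}$, consisting of $N_{\rm G}$ unitary gates with Pauli transfer matrices $\mathbf{G}_1,\dots,\mathbf{G}_{N_{\rm G}}$, where the imperfection of the $k$-th gate is modelled by a completely positive trace-preserving channel with Pauli transfer matrix $\mathbf{C}_k$ applied after the gate. Suppose the circuit is protected by Monte Carlo-based quantum error mitigation (as defined in the context) with number of effective circuit executions $N_{\rm s}$, in which the basis operators $\mathbf{O}_1,\dots,\mathbf{O}_L$ used for channel inversion are all (Pauli transfer matrices of) completely positive trace-nonincreasing operators. Let $\mathcal{M}_{\rm ob}$ be a Hermitian observable on $n$ qubits whose eigenvalues all lie in $[-1,1]$ and which satisfies $\mathrm{Tr}\{\mathcal{M}_{\rm ob}\}=0$. Let $\widetilde{r}$ be the decoherence-free computational result and $\mathsf{r}$ the (random) computational result of the protected circuit. Then the root-mean-square error satisfies $$\sqrt{\mathbb{E}\{(\mathsf{r}-\widetilde{r})^2\}}\le 2^{n/2}\sqrt{\exp\left(2N_{\rm G}N_{\rm s}^{-1}\right)-1}.$$ (In particular this covers the case where all channels are Pauli channels.)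
   Context: Pauli transfer matrix (PTM) representation: let $S_1=I,S_2,\dots,S_{4^n}$ be the $n$-qubit Pauli operators. A linear map $\mathcal{O}$ on $2^n\times 2^n$ matrices is represented by the $4^n\times 4^n$ matrix $[\mathbf{O}]_{i,j}=2^{-n}\mathrm{Tr}\{S_i\mathcal{O}(S_j)\}$; a state $\rho$ (and likewise an observable) is represented by the vector with entries $2^{-n/2}\mathrm{Tr}\{S_i\rho\}$. A unitary gate $G$ is represented by the PTM of $\rho\mapsto G\rho G^\dagger$. Let $\mathbf{v}_0$ and $\mathbf{v}_{\rm ob}$ be the vectors of the initial state and of $\mathcal{M}_{\rm ob}$. The decoherence-free result is $\widetilde{r}=\mathbf{v}_{\rm ob}^{\rm T}\mathbf{G}_{N_{\rm G}}\cdots\mathbf{G}_1\mathbf{v}_0$. Monte Carlo-based quantum error mitigation: each $\mathbf{C}_k$ is invertible and its inverse is written as $\mathbf{C}_k^{-1}=\sum_{l=1}^L[\boldsymbol{\alpha}_k]_l\mathbf{O}_l$ with a real vector $\boldsymbol{\alpha}_k$ satisfying $\mathbf{1}^{\rm T}\boldsymbol{\alpha}_k=1$. Set $[\mathbf{p}_k]_l=|[\boldsymbol{\alpha}_k]_l|/\|\boldsymbol{\alpha}_k\|_1$ (a probability vector) and $\mathbf{s}_k=\mathrm{sgn}\{\boldsymbol{\alpha}_k\}$ (entrywise). For each gate $k$, draw $N_{\rm s}\|\boldsymbol{\alpha}_k\|_1^2$ (taken to be a positive integer) i.i.d. samples from $\{1,\dots,L\}$ with distribution $\mathbf{p}_k$,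 independently across gates, and let $[\widetilde{\mathbf{p}}_k]_m$ be the fraction of these samples equal to $m$. Put $[\widetilde{\boldsymbol{\alpha}}_k]_l=\|\boldsymbol{\alpha}_k\|_1[\mathbf{s}_k]_l[\widetilde{\mathbf{p}}_k]_l$ and $\boldsymbol{\Gamma}_k=\sum_{l=1}^L[\widetilde{\boldsymbol{\alpha}}_k]_l\mathbf{O}_l$ (the approximate inverse channel). The residual channel is $\widetilde{\mathbf{C}}_k=\boldsymbol{\Gamma}_k\mathbf{C}_k$; the random state vectors are $\mathsf{v}_0=\mathbf{v}_0$, $\mathsf{v}_k=\widetilde{\mathbf{C}}_k\mathbf{G}_k\mathsf{v}_{k-1}$, and the computational result of the protected circuit is $\mathsf{r}=\mathbf{v}_{\rm ob}^{\rm T}\mathsf{v}_{N_{\rm G}}$. *)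

(* Defs.v *)
From HB Require Import structures.
From mathcomp Require Import all_boot all_order all_algebra.
From mathcomp Require Import all_classical all_reals all_analysis.
From mathcomp Require Import complex mxtens.

Set Implicit Arguments.
Unset Strict Implicit.
Unset Printing Implicit Defensive.

Import Order.TTheory GRing.Theory Num.Theory.
Import numFieldNormedType.Exports.

Local Open Scope classical_set_scope.
Local Open Scope complex_scope.
Local Open Scope sesquilinear_scope.
Local Open Scope ring_scope.

Section Operators.
Context {R : realType}.
Local Notation C := R[i].

Definition psdmx d (A : 'M[C]_d) : Prop :=
  forall v : 'cV[C]_d, 0 <= (v^t* *m A *m v) ord0 ord0.

(* id_k (x) O: the (a, b) block of X, a, b < k, is replaced by its image. *)
Definition ampliation k d (O : 'M[C]_d -> 'M[C]_d) (X : 'M[C]_(k * d)) :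
    'M[C]_(k * d) :=
  \sum_(a < k) \sum_(b < k)
    delta_mx a b *t
    O (\matrix_(r, s) X (mxtens_index (a, r)) (mxtens_index (b, s))).

Definition completely_positive d (O : 'M[C]_d -> 'M[C]_d) : Prop :=
  forall k (X : 'M[C]_(k * d)), psdmx X -> psdmx (ampliation O X).

Definition trace_preserving d (O : 'M[C]_d -> 'M[C]_d) : Prop :=
  forall A, \tr (O A) = \tr A.

Definition trace_nonincreasing d (O : 'M[C]_d -> 'M[C]_d) : Prop :=
  forall A, psdmx A -> \tr (O A) <= \tr A.

Definition unitary_conj d (U : 'M[C]_d) : 'M[C]_d -> 'M[C]_d :=
  fun A => U *m A *m U^t*.

End Operators.

Section Pauli.
Context {R : realType}.
Local Notation C := R[i].

(* Entry (x, y) of the single-qubit operator I, X, Y, Z for a = 0, 1, 2, 3. *)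
Definition pauli1 (a x y : nat) : C :=
  match a with
  | 0 => (x == y)%:R
  | 1 => (x != y)%:R
  | 2 => if x == y then 0 else if x == 0%N then - 'i else 'i
  | _ => if x == y then (-1) ^+ x else 0
  end.

Definition digit (b q i : nat) : nat := (i %/ b ^ q) %% b.

(* The tensor product over the n qubits, written entrywise: qubit q is in the
   computational basis state given by binary digit q of the matrix index, and
   carries the single-qubit operator given by base-4 digit q of a. *)
Definition pauli n (a : 'I_(4 ^ n)) : 'M[C]_(2 ^ n) :=
  \matrix_(x, y) \prod_(q < n)
     pauli1 (digit 4 q a) (digit 2 q x) (digit 2 q y).

Lemma pauli_herm n (a : 'I_(4 ^ n)) : (pauli a)^t* = pauli a.
Proof.
apply/matrixP => x y; rewrite !mxE rmorph_prod; apply: eq_bigr => q _.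
have := ltn_pmod (a %/ 4 ^ q) (isT : 0 < 4)%N.
have := ltn_pmod (x %/ 2 ^ q) (isT : 0 < 2)%N.
have := ltn_pmod (y %/ 2 ^ q) (isT : 0 < 2)%N.
rewrite -!/(digit _ _ _).
case: (digit 2 q y) => [|[|?]] //; case: (digit 2 q x) => [|[|?]] // _ _;
  case: (digit 4 q a) => [|[|[|[|?]]]] //= _;
  by rewrite ?rmorph0 ?rmorph1 ?rmorphN ?rmorphXn ?rmorphN ?rmorph1 //=
             ?conjCi ?opprK.
Qed.

(* The traces are real for Hermitian arguments and Hermiticity-preserving (in
   particular completely positive) maps, see ptmE and ptvecE; the real part only
   serves to view the entries in R. *)
Definition ptm n (O : 'M[C]_(2 ^ n) -> 'M[C]_(2 ^ n)) : 'M[R]_(4 ^ n) :=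
  \matrix_(i, j) ((2 ^+ n)^-1 * complex.Re (\tr (pauli i *m O (pauli j)))).

Definition ptvec n (A : 'M[C]_(2 ^ n)) : 'cV[R]_(4 ^ n) :=
  \col_i (2 `^ (- (n%:R / 2)) * complex.Re (\tr (pauli i *m A))).

Lemma trace_herm_real d (A B : 'M[C]_d) : A^t* = A -> B^t* = B ->
  (complex.Re (\tr (A *m B)))%:C = \tr (A *m B).
Proof.
move=> hA hB; apply/eqP; rewrite RRe_real //; apply/CrealP.
rewrite -{2}hA -{2}hB; rewrite [in RHS]mxtrace_mulC.
rewrite -[LHS]/(Num.conj (\tr (A *m B))) /mxtrace rmorph_sum.
apply: eq_bigr => i _; rewrite !mxE rmorph_sum; apply: eq_bigr => j _.
by rewrite !mxE rmorphM mulrC.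
Qed.

Lemma ptmE n (O : 'M[C]_(2 ^ n) -> 'M[C]_(2 ^ n)) i j :
  (forall A, A^t* = A -> (O A)^t* = O A) ->
  (ptm O i j)%:C = (2 ^+ n)^-1 * \tr (pauli i *m O (pauli j)).
Proof.
move=> hO; rewrite mxE rmorphM /= trace_herm_real ?pauli_herm//.
  by rewrite fmorphV rmorphXn rmorph_nat.
by apply: hO; rewrite pauli_herm.
Qed.

Lemma ptvecE n (A : 'M[C]_(2 ^ n)) i : A^t* = A ->
  (ptvec A i ord0)%:C = (2 `^ (- (n%:R / 2)) : R)%:C * \tr (pauli i *m A).
Proof.
by move=> hA; rewrite mxE rmorphM /= trace_herm_real ?pauli_herm.
Qed.

(* (|0><0|)^{(x) n} *)
Definition ket0_proj n : 'M[C]_(2 ^ n) :=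
  \matrix_(x, y) ((x == 0%N :> nat) && (y == 0%N :> nat))%:R.

End Pauli.

Section Sampling.
Context {R : realType}.

Definition l1norm L (a : 'I_L -> R) : R := \sum_l `|a l|.

Definition sample_prob L (a : 'I_L -> R) (l : 'I_L) : R := `|a l| / l1norm a.

Definition emp_freq L m (x : 'I_m -> 'I_L) (l : 'I_L) : R :=
  (#|[set i | x i == l]%SET|)%:R / m%:R.

Definition alpha_tilde L (a : 'I_L -> R) m (x : 'I_m -> 'I_L) (l : 'I_L) : R :=
  l1norm a * Num.sg (a l) * emp_freq x l.

Definition approx_inverse n L
    (O : 'I_L -> {linear 'M[R[i]]_(2 ^ n) -> 'M[R[i]]_(2 ^ n)})
    (a : 'I_L -> R) m (x : 'I_m -> 'I_L) : 'M[R]_(4 ^ n) :=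
  \sum_l alpha_tilde a x l *: ptm (O l).

(* A_(N-1) *m ... *m A_0 *m v *)
Definition circuit_state d N (A : 'I_N -> 'M[R]_d) (v : 'cV[R]_d) : 'cV[R]_d :=
  foldl (fun w k => A k *m w) v (enum 'I_N).

Definition ideal_result n N (G : 'I_N -> 'M[R[i]]_(2 ^ n))
    (M : 'M[R[i]]_(2 ^ n)) : R :=
  ((ptvec M)^T *m
   circuit_state (fun k => ptm (unitary_conj (G k))) (ptvec (ket0_proj n)))
    ord0 ord0.

(* x k i is the outcome of the i-th draw for gate k. *)
Definition protected_result n N L (G : 'I_N -> 'M[R[i]]_(2 ^ n))
    (Ch : 'I_N -> {linear 'M[R[i]]_(2 ^ n) -> 'M[R[i]]_(2 ^ n)})
    (O : 'I_L -> {linear 'M[R[i]]_(2 ^ n) -> 'M[R[i]]_(2 ^ n)})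
    (alpha : 'I_N -> 'I_L -> R) (m : 'I_N -> nat)
    (M : 'M[R[i]]_(2 ^ n)) (x : forall k, 'I_(m k) -> 'I_L) : R :=
  ((ptvec M)^T *m
   circuit_state
     (fun k => approx_inverse O (alpha k) (x k) *m ptm (Ch k)
               *m ptm (unitary_conj (G k)))
     (ptvec (ket0_proj n))) ord0 ord0.

End Sampling.

Section Independence.
Context {d : measure_display} {T : measurableType d} {R : realType}.
Variable P : probability T R.

Definition discrete_rv L (X : T -> 'I_L) : Prop :=
  forall l, measurable (X @^-1` [set l]).

Definition has_law L (X : T -> 'I_L) (p : 'I_L -> R) : Prop :=
  forall l, P (X @^-1` [set l]) = (p l)%:E.

Definition mutually_independent (I : finType) L (X : I -> T -> 'I_L) : Prop :=
  forall (J : {set I}) (B : I -> set 'I_L),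
    P (\bigcap_(i in [set` J]) (X i @^-1` B i)) =
    (\prod_(i in J) P (X i @^-1` B i))%E.

End Independence.

(* Main.v *)
(* Averaging over the draws of one gate, a product of two estimates has mean
   (inverse channel) (x) (inverse channel) when the draws differ, and is a mean
   over l of O_l (x) O_l, up to the factor |alpha|_1^2, when they coincide. So
   each gate k maps the second moment of v_(k-1) to
     (1 - 1/m_k) (G_k (x) G_k) + Ns^-1 \sum_l p_l (O_l C_k G_k)^((x) 2).
   Read against an observable, every branch of the resulting expansion is the
   square of the expectation of M in a subnormalized state, as the G_k, C_k and
   O_l are positive and trace-nonincreasing; such an expectation lies in [-1, 1].
   By induction on the gates E r^2 - (E r)^2 <= (1 + 1/Ns)^NG - 1, with E r the
   ideal result, which is stronger than the stated bound. *)
Require Import Defs.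
From HB Require Import structures.
From mathcomp Require Import all_boot all_order all_algebra.
From mathcomp Require Import all_classical all_reals all_analysis.
From mathcomp Require Import complex mxtens.
From mathcomp Require Import measurable_realfun ring lra.

Set Implicit Arguments.
Unset Strict Implicit.
Unset Printing Implicit Defensive.

Import Order.TTheory GRing.Theory Num.Theory.
Import numFieldNormedType.Exports.

Local Open Scope classical_set_scope.
Local Open Scope complex_scope.
Local Open Scope sesquilinear_scope.
Local Open Scope ring_scope.

(** * Expectations under finite product distributions *)

Section ProductExpectation.
Context {R : realType} {J T : finType}.
Implicit Types (p : J -> T -> R) (F H : {ffun J -> T} -> R).

(** As a finite sum, this lets the moment calculations proceed without measure theory. *)
Definition prod_expect p F : R :=
  \sum_(x : {ffun J -> T}) (\prod_j p j (x j)) * F x.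

Definition fupd (x : {ffun J -> T}) (j : J) (t : T) : {ffun J -> T} :=
  [ffun j' => if j' == j then t else x j'].

Lemma eq_prod_expect p F H : F =1 H -> prod_expect p F = prod_expect p H.
Proof. by move=> FH; apply: eq_bigr => x _; rewrite FH. Qed.

Lemma prod_expectD p F H :
  prod_expect p (fun x => F x + H x) = prod_expect p F + prod_expect p H.
Proof. by rewrite -big_split; apply: eq_bigr => x _; rewrite mulrDr. Qed.

Lemma prod_expectZ p c F :
  prod_expect p (fun x => c * F x) = c * prod_expect p F.
Proof. by rewrite mulr_sumr; apply: eq_bigr => x _; rewrite mulrCA. Qed.

Lemma prod_expect_sum (I : finType) p (F : I -> {ffun J -> T} -> R) :
  prod_expect p (fun x => \sum_i F i x) = \sum_i prod_expect p (F i).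
Proof. by rewrite exchange_big; apply: eq_bigr => x _; rewrite mulr_sumr. Qed.

Lemma prod_expect_cst p c :
  (forall j, \sum_t p j t = 1) -> prod_expect p (fun=> c) = c.
Proof.
move=> p1; rewrite /prod_expect -mulr_suml -(bigA_distr_bigA p).
by rewrite big1 ?mul1r.
Qed.

Lemma le_prod_expect p F H : (forall j t, 0 <= p j t) ->
  (forall x, F x <= H x) -> prod_expect p F <= prod_expect p H.
Proof.
by move=> p0 FH; apply: ler_sum => x _; rewrite ler_wpM2l// prodr_ge0.
Qed.

(* Swapping [x j] with an independent copy [t] is a weight-preserving
   involution of the pairs [(x, t)]. *)
Lemma prod_expect_resample p j F : \sum_t p j t = 1 ->
  prod_expect p F = prod_expect p (fun x => \sum_t p j t * F (fupd x j t)).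
Proof.
move=> pj1; rewrite /prod_expect.
under [RHS]eq_bigr do rewrite mulr_sumr.
rewrite pair_big /=.
pose sw (u : {ffun J -> T} * T) := (fupd u.1 j u.2, u.1 j).
have swK : involutive sw.
  move=> [x t]; rewrite /sw /=; congr (_, _); last by rewrite ffunE eqxx.
  by apply/ffunP => i; rewrite !ffunE; case: eqP => // ->.
rewrite [RHS](reindex_inj (inv_inj swK)) /=.
transitivity (\sum_(u : {ffun J -> T} * T)
    (\prod_i p i (u.1 i)) * F u.1 * p j u.2).
  rewrite -(pair_bigA _ (fun (x : {ffun J -> T}) t =>
    (\prod_i p i (x i)) * F x * p j t)) /=.
  by apply: eq_bigr => x _; rewrite -mulr_sumr pj1 mulr1.
apply: eq_bigr => -[x t] _ /=.
have -> : fupd (fupd x j t) j (x j) = x.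
  by apply/ffunP => i; rewrite !ffunE; case: eqP => // ->.
rewrite (bigD1 j)//= [in RHS](bigD1 j)//= ffunE eqxx.
have -> : \prod_(i | i != j) p i (fupd x j t i) = \prod_(i | i != j) p i (x i).
  by apply: eq_bigr => i /negbTE ij; rewrite ffunE ij.
ring.
Qed.

End ProductExpectation.

(** The events fixing all draws partition [Omega], and independence gives each the product of the
    single-draw weights. The random variable is thus a finite combination of indicators, integrated
    termwise since [F] is nonnegative. *)
Lemma expectation_discrete {R : realType} (J : finType) (L : nat)
    (d : measure_display) (Omega : measurableType d) (P : probability Omega R)
    (Y : J -> Omega -> 'I_L) (p : J -> 'I_L -> R) (F : {ffun J -> 'I_L} -> R) :
    (forall j, discrete_rv (Y j)) -> (forall j, has_law P (Y j) (p j)) ->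
    mutually_independent P Y -> (forall x, 0 <= F x) ->
  ('E_P[fun w => F [ffun j => Y j w]] = (prod_expect p F)%:E)%E.
Proof.
move=> Yrv Ylaw Yind F0.
pose A (x : {ffun J -> 'I_L}) : set Omega :=
  \bigcap_(j in [set` [set: J]%SET]) (Y j @^-1` [set x j]).
have mA x : measurable (A x).
  apply: fin_bigcap_measurable => [|j _]; last exact: Yrv.
  exact: finite_finset.
have AE x w : (w \in A x) = (x == [ffun j => Y j w]).
  apply/idP/eqP => [|->]; rewrite inE /A.
    move=> Aw; apply/ffunP => j; rewrite ffunE.
    by apply/esym/(Aw j); rewrite /= finset.in_setT.
  by move=> j _ /=; rewrite ffunE.
have PA x : P (A x) = (\prod_j p j (x j))%:E.
  rewrite /A (Yind [set: J]%SET (fun j => [set x j])).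
  rewrite -prodEFin; apply: eq_big => [j|j _]; last exact: Ylaw.
  by rewrite finset.in_setT.
rewrite unlock.
(* At each [w] exactly one indicator is nonzero, that of the observed outcome. *)
rewrite (eq_integral (fun w => \sum_x (F x)%:E * (\1_(A x) w)%:E)%E); last first.
  move=> w _; rewrite (bigD1 [ffun j => Y j w])//= indicE AE eqxx mule1.
  rewrite big1 ?adde0// => x /negbTE xw.
  by rewrite indicE AE xw mule0.
rewrite ge0_integral_sum//; last 2 first.
- move=> x; apply: measurable_funeM.
  by apply/measurable_EFinP; exact: measurable_indic.
- by move=> x w _; rewrite mule_ge0 ?lee_fin// indicE.
rewrite /prod_expect -sumEFin; apply: eq_bigr => x _.
rewrite ge0_integralZl ?lee_fin//; last first.
  by apply/measurable_EFinP; exact: measurable_indic.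
rewrite integral_indic// setIT EFinM muleC; congr (_ * _)%E; exact: PA.
Qed.

(** * Positive matrices, subnormalized states and bounded observables *)

Section Positivity.
Context {R : realType}.
Local Notation C := R[i].

(** Subnormalized rather than unit-trace states, so that the class is stable under the basis
    operators, which may lose trace. *)
Definition substate d (A : 'M[C]_d) : Prop := psdmx A /\ \tr A <= 1.

Definition positive_tni d (O : 'M[C]_d -> 'M[C]_d) : Prop :=
  (forall A, psdmx A -> psdmx (O A)) /\ trace_nonincreasing O.

Lemma positive_tni_substate d (O : 'M[C]_d -> 'M[C]_d) A :
  positive_tni O -> substate A -> substate (O A).
Proof.
move=> [Opos Otni] [A0 A1]; split; first exact: Opos.
exact: le_trans (Otni _ A0) A1.
Qed.

Lemma psdmx_conj d (U A : 'M[C]_d) : psdmx A -> psdmx (U *m A *m U^t*).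
Proof.
by move=> A0 v; have := A0 (U^t* *m v);
  rewrite trmx_mul map_mxM /= trmxCK !mulmxA.
Qed.

Lemma conj_deltaE d e (A : 'M[C]_(d, e)) i j :
  (((delta_mx i ord0)^t* : 'rV[C]_d) *m A *m (delta_mx j ord0 : 'cV[C]_e))
    ord0 ord0 = A i j.
Proof. by rewrite trmx_delta map_delta_mx -rowE -colE !mxE. Qed.

Lemma psdmx_diag d (A : 'M[C]_d) i : psdmx A -> 0 <= A i i.
Proof. by move=> /(_ (delta_mx i ord0)); rewrite conj_deltaE. Qed.

(** Polarization: the form is real at e_i + c e_j and on the diagonal, so c A_ij + c^* A_ji is real;
    c = 1 and c = i together give A_ij = A_ji^*. *)
Lemma psdmx_herm d (A : 'M[C]_d) : psdmx A -> A^t* = A.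
Proof.
move=> A0.
have polar i j c : c * A i j + c^* * A j i \is Num.real.
  have /ger0_real := A0 (delta_mx i ord0 + c *: delta_mx j ord0).
  have -> : (delta_mx i ord0 + c *: delta_mx j ord0 : 'cV[C]_d)^t* =
      (delta_mx i ord0)^t* + c^* *: (delta_mx j ord0)^t*.
    by apply/matrixP => a b; rewrite !mxE rmorphD rmorphM.
  rewrite !mulmxDl !mulmxDr.
  rewrite -!scalemxAl -!scalemxAr.
  have entry (B1 B2 B3 B4 : 'M[C]_1) k l :
      (B1 + c *: B2 + (c^* *: B3 + c^* *: (c *: B4))) k l =
      B1 k l + (c * B2 k l + (c^* * B3 k l + c^* * (c * B4 k l))).
    by rewrite !mxE -addrA.
  rewrite entry !conj_deltaE.
  rewrite rpredDl; last exact/ger0_real/psdmx_diag.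
  rewrite addrA rpredDr//; apply: ger0_real.
  by rewrite mulrA [c^* * c]mulrC mulr_ge0 ?psdmx_diag ?mul_conjC_ge0.
apply/matrixP => i j; rewrite !mxE.
have /CrealP := polar i j 'i; have /CrealP := polar i j 1.
rewrite conjC1 conjCi !mul1r mulNr rmorphB !rmorphD !rmorphM /= conjCi !mulNr.
move=> h1 h2.
have {}h2 : - (A i j)^* + (A j i)^* = A i j - A j i.
  apply: (@mulfI _ 'i); [exact: neq0Ci|rewrite !mulrDr !mulrN].
  by move: h2; rewrite opprK.
apply: (@mulfI _ 2); first by rewrite pnatr_eq0.
rewrite !mulr_natl !mulr2n; transitivity (A i j + A j i + (A i j - A j i)).
  by rewrite -h1 -h2; ring.
by ring.
Qed.

Lemma psdmx_cast d d' (e : d = d') (A : 'M[C]_d) :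
  psdmx (castmx (e, e) A) <-> psdmx A.
Proof. by case: _ / e; rewrite castmx_id. Qed.

(** This is the ampliation with k = 1, up to the cast along 1 * d = d. *)
Lemma completely_positive_psd d (O : 'M[C]_d -> 'M[C]_d) A :
  completely_positive O -> psdmx A -> psdmx (O A).
Proof.
move=> Ocp A0; pose e := esym (mul1n d).
apply/(psdmx_cast e).
suff -> : castmx (e, e) (O A) = ampliation O ((1%:M : 'M[C]_1) *t A).
  by apply: Ocp; rewrite tens_scalar1mx; apply/psdmx_cast.
rewrite /ampliation !big_ord1.
have -> : delta_mx ord0 ord0 = 1%:M :> 'M[C]_1.
  by apply/matrixP => a b; rewrite !mxE !ord1.
rewrite tens_scalar1mx; congr (castmx _ (O _)).
by apply/matrixP => a b; rewrite mxE tensmxE mxE mul1r.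
Qed.

Lemma hermitian_diagonalization d (M : 'M[C]_d) : M \is hermsymmx ->
  exists (Q : 'M[C]_d) (D : 'rV[C]_d),
    [/\ Q \is unitarymx, forall i, D ord0 i \is Num.real &
        M = Q^t* *m diag_mx D *m Q].
Proof.
move=> Mh; exists (spectralmx M), (spectral_diag M).
have /orthomx_spectralP := hermitian_normalmx Mh.
rewrite invmx_unitary ?spectral_unitarymx// => ME.
by split=> // i; apply: mxOverP; exact: hermitian_spectral_diag_real.
Qed.

(** In an eigenbasis of [M] the trace weighs the eigenvalues by the diagonal of the rotated [A]:
    nonnegative weights of total at most 1. *)
Lemma trace_bound d (M A : 'M[C]_d) : M \is hermsymmx ->
  (forall a, eigenvalue M a -> -1 <= a <= 1) -> substate A ->
  `|\tr (M *m A)| <= 1.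
Proof.
move=> /hermitian_diagonalization[Q [D [QU Dreal ME]]] Msp [A0 A1].
have QQ : Q *m Q^t* = 1%:M by exact/unitarymxP.
have QM : Q *m M = diag_mx D *m Q by rewrite ME !mulmxA QQ mul1mx.
(* Row i of [Q] is a left eigenvector for [D ord0 i]; it is nonzero, as otherwise [Q *m Q^t*] would
   have a zero row. *)
have D1 i : `|D ord0 i| <= 1.
  rewrite real_ler_norml//; apply: Msp.
  apply/eigenvalueP; exists (row i Q).
    by rewrite -row_mul QM row_mul row_diag_mx -scalemxAl -rowE.
  apply/eqP => Qi0.
  have /rowP/(_ i)/eqP : row i (Q *m Q^t*) = 0 by rewrite row_mul Qi0 mul0mx.
  by rewrite QQ !mxE eqxx oner_eq0.
pose B := Q *m A *m Q^t*.
have B0 : psdmx B by exact: psdmx_conj.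
have trB : \tr B = \tr A.
  rewrite mxtrace_mulC mulmxA -invmx_unitary// mulVmx ?mul1mx//.
  exact: unitarymx_unit.
have -> : \tr (M *m A) = \sum_i D ord0 i * B i i.
  transitivity (\tr (diag_mx D *m B)).
    by rewrite ME -2!mulmxA [LHS]mxtrace_mulC /B !mulmxA.
  by rewrite mul_diag_mx; apply: eq_bigr => i _; rewrite mxE.
rewrite (le_trans (ler_norm_sum _ _ _))//.
apply: le_trans A1; rewrite -trB; apply: ler_sum => i _.
by rewrite normrM (ger0_norm (psdmx_diag _ B0)) ler_piMl// psdmx_diag.
Qed.

Lemma unitary_conj_positive_tni d (U : 'M[C]_d) :
  U \is unitarymx -> positive_tni (unitary_conj U).
Proof.
move=> UU; split=> [A|A _]; first exact: psdmx_conj.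
rewrite /unitary_conj mxtrace_mulC mulmxA -invmx_unitary//.
by rewrite mulVmx ?mul1mx// unitarymx_unit.
Qed.

Lemma substate_ket0_proj n : substate (ket0_proj n : 'M[C]_(2 ^ n)).
Proof.
have n0 : (0 < 2 ^ n)%N by rewrite expn_gt0.
have -> : ket0_proj n = delta_mx (Ordinal n0) (Ordinal n0) :> 'M[C]_(2 ^ n).
  by apply/matrixP => x y; rewrite !mxE.
split.
  move=> v; rewrite -(mul_delta_mx (ord0 : 'I_1)) !mulmxA.
  rewrite -colE -mulmxA -rowE mxE big_ord1 !mxE.
  by rewrite mulrC mul_conjC_ge0.
rewrite -(mul_delta_mx (ord0 : 'I_1)) mxtrace_mulC mul_delta_mx.
by rewrite /mxtrace big_ord1 mxE.
Qed.
End Positivity.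

(** * Completeness of the Pauli basis and the transfer matrix calculus *)

Section PauliBasis.
Context {R : realType}.
Local Notation C := R[i].

Lemma digit0 b x : digit b 0 x = (x %% b)%N.
Proof. by rewrite /digit expn0 divn1. Qed.

Lemma digitS b q x : digit b q.+1 x = digit b q (x %/ b).
Proof. by rewrite /digit expnS divnMA. Qed.

Lemma digit_inj b n x y : (x < b ^ n)%N -> (y < b ^ n)%N ->
  (forall q, (q < n)%N -> digit b q x = digit b q y) -> x = y.
Proof.
elim: n x y => [|n IH] x y.
  by rewrite expn0 !ltnS !leqn0 => /eqP-> /eqP->.
case: b IH => [|b] IH; first by rewrite exp0n.
rewrite expnSr => xn yn xy.
rewrite (divn_eq x b.+1) (divn_eq y b.+1) -!digit0 xy//.
congr (_ * _ + _)%N; apply: IH; rewrite ?ltn_divLR// => q qn.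
by rewrite -!digitS xy.
Qed.

(** Distributivity with numerals in the role of digit sequences; the induction splits off the least
    significant digit. *)
Lemma sum_prod_digit (S : comNzRingType) b n (f : nat -> nat -> S) :
  \sum_(j < b ^ n) \prod_(q < n) f q (digit b q j) =
  \prod_(q < n) \sum_(a < b) f q a.
Proof.
elim: n f => [|n IH] f.
  by rewrite expn0 big_ord1 !big_ord0.
rewrite big_ord_recl -(IH (fun q => f q.+1)) mulrC mulr_sum expnSr.
apply: eq_bigr => j _; rewrite big_ord_recl digit0 mulrC; congr (_ * _).
by apply: eq_bigr => q _; rewrite digitS.
Qed.

Lemma pauli1_complete x y u v :
    (x < 2)%N -> (y < 2)%N -> (u < 2)%N -> (v < 2)%N ->
  \sum_(a < 4) pauli1 a x y * pauli1 a u v =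
  2 * ((x == v)%:R * (y == u)%:R) :> C.
Proof.
rewrite !big_ord_recl big_ord0 /=.
case: x => [|[|?]] //; case: y => [|[|?]] //; case: u => [|[|?]] //;
  case: v => [|[|?]] // _ _ _ _;
  rewrite /= ?(mulr0, mul0r, addr0, add0r, mulr1, mul1r, expr0, expr1, mulrN,
    mulNr, opprK, subrr, addrN, addNr) -?expr2 ?sqrCi ?opprK ?subrr ?addNr //.
Qed.

(** In tensor form, the sum of S_j (x) S_j is 2^n times the swap; it factors over the qubits into
    single-qubit swaps. *)
Lemma pauli_complete n (x y u v : 'I_(2 ^ n)) :
  \sum_j pauli j x y * pauli j u v =
  2 ^+ n * ((x == v)%:R * (y == u)%:R) :> C.
Proof.
under eq_bigr do rewrite !mxE -big_split /=.
rewrite (sum_prod_digit 4 n (fun q a =>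
   pauli1 a (digit 2 q x) (digit 2 q y) *
   pauli1 a (digit 2 q u) (digit 2 q v))).
have lt2 q z : (digit 2 q z < 2)%N by rewrite ltn_mod.
under eq_bigr do rewrite pauli1_complete//.
(* Distinct indices differ in some binary digit, which makes a factor vanish. *)
have digE (z w : 'I_(2 ^ n)) :
    \prod_(q < n) (digit 2 q z == digit 2 q w)%:R = (z == w)%:R :> C.
  have [->|zw] := eqVneq z w; first by rewrite big1// => q _; rewrite eqxx.
  apply/eqP/prodf_eq0.
  have [q zwq] : exists q : 'I_n, digit 2 q z != digit 2 q w.
    apply/existsP; apply: contraNT zw; rewrite negb_exists => /forallP zw.
    apply/eqP/val_inj/(digit_inj (ltn_ord z) (ltn_ord w)) => q qn.
    by apply/eqP; have := zw (Ordinal qn); rewrite negbK.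
  by exists q; rewrite // (negbTE zwq).
by rewrite !big_split /= prodr_const card_ord !digE.
Qed.

Lemma pauli_expansion n (A : 'M[C]_(2 ^ n)) :
  A = (2 ^+ n)^-1 *: \sum_j \tr (pauli j *m A) *: pauli j.
Proof.
apply/matrixP => u v; rewrite mxE summxE.
under eq_bigr do rewrite mxE mulr_suml.
rewrite exchange_big /=.
under eq_bigr => x _.
  under eq_bigr do rewrite mxE mulr_suml.
  rewrite exchange_big /=.
  under eq_bigr => y _.
    under eq_bigr do rewrite mulrAC.
    rewrite -mulr_suml pauli_complete.
    over.
  over.
rewrite (bigD1 v)//= (bigD1 u)//= !eqxx !mulr1.
rewrite big1 ?addr0; last by move=> y /negbTE ->; rewrite !(mulr0, mul0r).
rewrite big1 ?addr0; last first.
  by move=> x /negbTE ->; rewrite big1// => y _; rewrite !(mulr0, mul0r).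
by rewrite mulKf// expf_neq0// pnatr_eq0.
Qed.

Lemma Re_realM (r : R) (z : C) : complex.Re (r%:C * z) = r * complex.Re z.
Proof. by case: z => a b /=; rewrite mul0r subr0. Qed.

(** Pauli coefficients of a Hermitian matrix are real, so real parts pass through the expansion. A
    general functional [f] serves both the action of [ptm] and the inner product of [ptvec]s. *)
Lemma trace_pauli_expansion n (A : 'M[C]_(2 ^ n))
    (f : {linear 'M[C]_(2 ^ n) -> C}) :
  A^t* = A ->
  complex.Re (f A) = (2 ^+ n)^-1 *
    \sum_j complex.Re (\tr (pauli j *m A)) * complex.Re (f (pauli j)).
Proof.
move=> Ah; rewrite {1}(pauli_expansion A) linearZ linear_sum /=.
have -> : (2 ^+ n)^-1 = ((2 ^+ n)^-1 : R)%:C :> C.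
  by rewrite fmorphV rmorphXn rmorph_nat.
rewrite Re_realM raddf_sum /=; congr (_ * _); apply: eq_bigr => j _.
by rewrite linearZ -Re_realM trace_herm_real// pauli_herm.
Qed.

Lemma ptm_mul_ptvec n (O : {linear 'M[C]_(2 ^ n) -> 'M[C]_(2 ^ n)}) A :
  A^t* = A -> ptm O *m ptvec A = ptvec (O A).
Proof.
move=> Ah; apply/colP => i; rewrite !mxE.
rewrite (trace_pauli_expansion (mxtrace \o mulmx (pauli i) \o O) Ah) /=.
rewrite mulrCA mulr_sumr mulr_sumr; apply: eq_bigr => j _; rewrite !mxE /=.
ring.
Qed.

Lemma ptvec_dot n (A B : 'M[C]_(2 ^ n)) : A^t* = A -> B^t* = B ->
  ((ptvec A)^T *m ptvec B) ord0 ord0 = complex.Re (\tr (A *m B)).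
Proof.
move=> Ah Bh.
rewrite (trace_pauli_expansion (mxtrace \o mulmx A) Bh) /= mxE mulr_sumr.
apply: eq_bigr => j _; rewrite !mxE [\tr (A *m _)]mxtrace_mulC.
(* The normalizations of the two vectors multiply to that of the Pauli expansion. *)
rewrite -(_ : 2 `^ (- (n%:R / 2)) * 2 `^ (- (n%:R / 2)) = (2 ^+ n)^-1).
  by ring.
rewrite -powRD; last by rewrite pnatr_eq0 implybT.
by rewrite -opprD -splitr powRN powR_mulrn.
Qed.
End PauliBasis.

(** * Importance sampling of a signed combination *)

Section Sampling.
Context {R : realType} {L : nat}.
Implicit Types (a c : 'I_L -> R).

(** The signed importance weight of an outcome: under [sample_prob a] it reproduces [a] on
    average. *)
Definition score a l : R := l1norm a * Num.sg (a l).

Lemma sample_prob_ge0 a l : 0 <= sample_prob a l.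
Proof. by rewrite divr_ge0// sumr_ge0. Qed.

Lemma sum_sample_prob a : l1norm a != 0 -> \sum_l sample_prob a l = 1.
Proof. by move=> a0; rewrite -mulr_suml mulfV. Qed.

Lemma sample_prob_score a l : l1norm a != 0 ->
  sample_prob a l * score a l = a l.
Proof.
by move=> a0; rewrite /sample_prob /score mulrA mulfVK// mulrC -numEsg.
Qed.

(** Equality fails only where the sign of [a l] is 0 and the norm is not. *)
Lemma score_sqr_le a l : score a l ^+ 2 <= l1norm a ^+ 2.
Proof.
rewrite exprMn ler_piMr ?sqr_ge0//.
by case: sgrP => _; rewrite ?expr0n ?sqrrN ?expr1n.
Qed.

(** Writing the frequencies as averages of indicators and exchanging sums gives a sample mean, whose
    moments can be taken draw by draw. *)
Lemma alpha_tilde_sum a c m (x : 'I_m -> 'I_L) :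
  \sum_l alpha_tilde a x l * c l = m%:R^-1 * \sum_i score a (x i) * c (x i).
Proof.
transitivity (\sum_l \sum_i m%:R^-1 * ((x i == l)%:R * (score a l * c l))).
  apply: eq_bigr => l _; rewrite -mulr_sumr -mulr_suml -natr_sum.
  have -> : (\sum_i (x i == l) = #|[set i | x i == l]%SET|)%N.
    by rewrite -sum1dep_card [RHS]big_mkcond; apply: eq_bigr => i _; case: eqP.
  by rewrite /alpha_tilde /emp_freq /score; ring.
rewrite exchange_big mulr_sumr; apply: eq_bigr => i _.
rewrite -mulr_sumr (bigD1 (x i))//= eqxx mul1r big1 ?addr0// => l.
by rewrite eq_sym => /negbTE ->; rewrite mul0r.
Qed.

End Sampling.

(** * First and second moments of the protected circuit *)

Section Circuit.
Context {R : realType} {N L D : nat} {m : 'I_N -> nat}.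
Local Notation J := {k : 'I_N & 'I_(m k)}.
Context (alpha : 'I_N -> 'I_L -> R) (Ns : R).
Context (l1_neq0 : forall k, l1norm (alpha k) != 0).
Context (m_gt0 : forall k, (0 < m k)%N) (Ns_gt0 : 0 < Ns).
Context (mE : forall k, (m k)%:R = Ns * l1norm (alpha k) ^+ 2).
Local Notation draw i := (Tagged (fun k => 'I_(m k)) i).
Local Notation p := (fun j : J => sample_prob (alpha (tag j))).
Local Notation "'E' F" := (prod_expect p F) (at level 10, F at level 9).

Let p1 j : \sum_l p j l = 1. Proof. exact: sum_sample_prob. Qed.
Let p0 j l : 0 <= p j l. Proof. exact: sample_prob_ge0. Qed.

Section OneGate.
Context (k : 'I_N) (c : {ffun J -> 'I_L} -> 'I_L -> R).
Context (c_indep : forall x i t, c (fupd x (draw (i : 'I_(m k))) t) =1 c x).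

Local Notation mu := (fun x => \sum_l alpha k l * c x l).
Local Notation Y i :=
  (fun x : {ffun J -> 'I_L} =>
    score (alpha k) (x (draw (i : 'I_(m k)))) *
    c x (x (draw (i : 'I_(m k))))).
Local Notation est := (fun x : {ffun J -> 'I_L} =>
  \sum_l alpha_tilde (alpha k) (fun i : 'I_(m k) => x (draw i)) l * c x l).

(** Here [c x l] models the readout when operator l is inserted at gate k, unaffected by that gate's
    draws. Resampling draw i averages its score to [alpha k], while [g] ignores this draw and
    factors out. *)
Lemma expect_draw (i : 'I_(m k)) g :
  (forall x t, g (fupd x (draw i) t) = g x) ->
  E (fun x => g x * Y i x) = E (fun x => g x * mu x).
Proof.
move=> gi; rewrite (prod_expect_resample (j := draw i))//.
apply: eq_prod_expect => x; rewrite mulr_sumr; apply: eq_bigr => t _.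
rewrite gi ffunE eqxx c_indep mulrCA; congr (_ * _).
by rewrite mulrA sample_prob_score.
Qed.

Lemma expect_estimate : E est = E mu.
Proof.
rewrite (eq_prod_expect _ (fun x => alpha_tilde_sum _ _ _)).
rewrite prod_expectZ prod_expect_sum.
under eq_bigr => i _.
  rewrite (@eq_prod_expect _ _ _ _ _ (fun x => 1 * Y i x)); last first.
    by move=> x; rewrite mul1r.
  rewrite (expect_draw (g := fun=> 1))//.
  over.
rewrite sumr_const card_ord -[X in _ * X]mulr_natl.
rewrite mulKf ?pnatr_eq0 ?lt0n_neq0//.
by apply: eq_prod_expect => x; rewrite mul1r.
Qed.

Lemma expect_draw_sqr (i : 'I_(m k)) :
  E (fun x => Y i x * Y i x) <=
  l1norm (alpha k) ^+ 2 *
  \sum_l sample_prob (alpha k) l * E (fun x => c x l ^+ 2).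
Proof.
rewrite (prod_expect_resample (j := draw i))// mulr_sumr.
rewrite [leRHS](_ : _ = E (fun x => \sum_l l1norm (alpha k) ^+ 2 *
    (sample_prob (alpha k) l * c x l ^+ 2))); last first.
  rewrite prod_expect_sum; apply: eq_bigr => l _.
  by rewrite !prod_expectZ.
apply: le_prod_expect => // x; apply: ler_sum => l _.
rewrite ffunE eqxx c_indep -expr2 exprMn mulrCA.
by rewrite ler_wpM2r ?score_sqr_le// mulr_ge0 ?sample_prob_ge0 ?sqr_ge0.
Qed.

(** Two uses of [expect_draw]: draw i' is averaged with [Y i] frozen, then draw i with [mu]
    frozen. *)
Lemma expect_draw_cross (i i' : 'I_(m k)) : i != i' ->
  E (fun x => Y i x * Y i' x) = E (fun x => mu x ^+ 2).
Proof.
have mu_indep x (j : 'I_(m k)) t : mu (fupd x (draw j) t) = mu x.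
  by apply: eq_bigr => l _; rewrite c_indep.
move=> ii'; rewrite (expect_draw (i := i') (g := Y i)); last first.
  move=> x t; rewrite ffunE -tag_eqE /tag_eq /= eqxx tagged_asE (negbTE ii').
  by rewrite c_indep.
under eq_prod_expect do rewrite mulrC.
rewrite (expect_draw (g := mu)); last by move=> x t; exact: mu_indep.
by apply: eq_prod_expect => x; rewrite expr2.
Qed.

(** Squaring the sample mean leaves pairs of draws: distinct ones contribute the squared mean,
    coinciding ones the variance cost. *)
Lemma expect_estimate_sqr :
  E (fun x => est x ^+ 2) <= E (fun x => mu x ^+ 2) +
    Ns^-1 * \sum_l sample_prob (alpha k) l * E (fun x => c x l ^+ 2).
Proof.
set Q := E (fun x => mu x ^+ 2); set S := \sum_l _.
have Q0 : 0 <= Q.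
  rewrite -(prod_expect_cst 0 p1) le_prod_expect// => x.
  exact: sqr_ge0.
have -> : E (fun x => est x ^+ 2) =
    (m k)%:R^-1 ^+ 2 * \sum_i \sum_i' E (fun x => Y i x * Y i' x).
  under [in RHS]eq_bigr do rewrite -prod_expect_sum.
  rewrite -prod_expect_sum -prod_expectZ; apply: eq_prod_expect => x.
  rewrite alpha_tilde_sum exprMn; congr (_ * _).
  by rewrite expr2 mulr_suml; apply: eq_bigr => i _; rewrite mulr_sumr.
have : \sum_i \sum_i' E (fun x => Y i x * Y i' x) <=
    \sum_(i < m k) (l1norm (alpha k) ^+ 2 * S + (m k)%:R * Q).
  (* The m_k - 1 off-diagonal terms are counted as m_k, which only enlarges the bound because [Q] is
     nonnegative. *)
  apply: ler_sum => i _; rewrite (bigD1 i)//= lerD ?expect_draw_sqr//.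
  rewrite (eq_bigr (fun=> Q)); last first.
    by move=> i' ii'; rewrite expect_draw_cross// eq_sym.
  rewrite sumr_const -[leLHS]mulr_natl ler_wpM2r// ler_nat.
  by rewrite (leq_trans (max_card _))// card_ord.
rewrite sumr_const card_ord -[leRHS]mulr_natl => le.
apply: le_trans (ler_wpM2l (sqr_ge0 _) le) _.
(* The choice of m_k makes the squared norm over m_k equal to 1/Ns, for every gate. *)
rewrite [leLHS](_ : _ = Q + Ns^-1 * S)// mE; field.
by rewrite l1_neq0 gt_eqF.
Qed.

End OneGate.

Context (Gm Cm : 'I_N -> 'M[R]_D) (Om : 'I_L -> 'M[R]_D) (v0 : 'cV[R]_D).
Context (CmK : forall k, (\sum_l alpha k l *: Om l) *m Cm k = 1%:M).

(** An arbitrary gate sequence allows induction on the last gate, whose operators are moved onto the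
    readout covector, as in the Heisenberg picture. *)
Definition noisy_state (s : seq 'I_N) (x : {ffun J -> 'I_L}) : 'cV[R]_D :=
  foldl (fun w k =>
    (\sum_l alpha_tilde (alpha k) (fun i : 'I_(m k) => x (draw i)) l *: Om l)
      *m Cm k *m Gm k *m w) v0 s.

Definition ideal_state (s : seq 'I_N) : 'cV[R]_D :=
  foldl (fun w k => Gm k *m w) v0 s.

(** Supplies the hypothesis [c_indep] of the one-gate estimates. *)
Lemma noisy_state_indep s x k (i : 'I_(m k)) t : k \notin s ->
  noisy_state s (fupd x (draw i) t) = noisy_state s x.
Proof.
elim/last_ind: s => [//|s k' IH].
rewrite mem_rcons inE negb_or => /andP[kk' ks].
rewrite /noisy_state !foldl_rcons -!/(noisy_state _ _) IH//.
do 3![congr (_ *m _)].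
apply: eq_bigr => l _; congr (_ *: _); congr (alpha_tilde _ _ _).
apply/funext => i'; rewrite ffunE -tag_eqE /tag_eq /=.
by rewrite eq_sym (negbTE kk').
Qed.

Lemma noisy_state_rcons s k x (w : 'rV[R]_D) :
  (w *m noisy_state (rcons s k) x) ord0 ord0 =
  \sum_l alpha_tilde (alpha k) (fun i : 'I_(m k) => x (draw i)) l *
    (w *m (Om l *m Cm k *m Gm k) *m noisy_state s x) ord0 ord0.
Proof.
rewrite /noisy_state foldl_rcons -/(noisy_state _ _) !mulmxA.
rewrite mulmx_sumr !mulmx_suml summxE; apply: eq_bigr => l _.
by rewrite -scalemxAr -!scalemxAl mxE !mulmxA.
Qed.

(** The mean weights rebuild the inverse channel, which cancels [Cm k]. *)
Lemma inverse_channel s k x (w : 'rV[R]_D) :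
  \sum_l alpha k l * (w *m (Om l *m Cm k *m Gm k) *m noisy_state s x) ord0 ord0
  = (w *m Gm k *m noisy_state s x) ord0 ord0.
Proof.
rewrite -[in RHS](mulmx1 w) -(CmK k) !mulmxA.
rewrite mulmx_sumr !mulmx_suml summxE; apply: eq_bigr => l _.
by rewrite -scalemxAr -!scalemxAl [RHS]mxE !mulmxA.
Qed.

Lemma expect_noisy s (w : 'rV[R]_D) : uniq s ->
  E (fun x => (w *m noisy_state s x) ord0 ord0) =
  (w *m ideal_state s) ord0 ord0.
Proof.
elim/last_ind: s w => [|s k IH] w.
  by move=> _; exact: (prod_expect_cst ((w *m v0) ord0 ord0) p1).
rewrite rcons_uniq => /andP[ks us].
rewrite (eq_prod_expect _ (fun x => noisy_state_rcons _ _ _ _)).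
rewrite expect_estimate; last by move=> x i t l; rewrite noisy_state_indep.
rewrite (eq_prod_expect _ (fun x => inverse_channel _ _ _ _)) IH//.
by rewrite /ideal_state foldl_rcons mulmxA.
Qed.

(** [B] is a class of readouts, stable under all branches, with ideal values in [-1, 1]. If q - 1
    bounds the excess before a gate, each branch has second moment at most 1 + (q - 1) = q, so the
    gate adds at most q / Ns. *)
Lemma expect_noisy_sqr (B : 'rV[R]_D -> Prop) s (w : 'rV[R]_D) :
    (forall w k, B w -> B (w *m Gm k)) ->
    (forall w k l, B w -> B (w *m (Om l *m Cm k *m Gm k))) ->
    (forall w s, B w -> `|(w *m ideal_state s) ord0 ord0| <= 1) ->
    uniq s -> B w ->
  E (fun x => (w *m noisy_state s x) ord0 ord0 ^+ 2) <=
  (w *m ideal_state s) ord0 ord0 ^+ 2 + ((1 + Ns^-1) ^+ size s - 1).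
Proof.
move=> BG BO B1; elim/last_ind: s w => [|s k IH] w.
  by move=> _ _; rewrite expr0 subrr addr0 /noisy_state /= prod_expect_cst.
rewrite rcons_uniq => /andP[ks us] Bw; rewrite size_rcons.
under eq_prod_expect do rewrite noisy_state_rcons.
apply: (le_trans (expect_estimate_sqr _)).
  by move=> x i t l; rewrite noisy_state_indep.
under eq_prod_expect do rewrite inverse_channel.
set q := (1 + Ns^-1) ^+ size s.
rewrite [ideal_state (rcons s k)](_ : _ = Gm k *m ideal_state s); last first.
  by rewrite /ideal_state foldl_rcons.
rewrite mulmxA [leRHS](_ : _ = ((w *m Gm k *m ideal_state s) ord0 ord0 ^+ 2 +
  (q - 1)) + Ns^-1 * q); last by rewrite [_ ^+ (size s).+1]exprSr -/q; ring.
apply: lerD; first by apply: IH => //; exact: BG.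
rewrite ler_pM2l ?invr_gt0//.
(* The branches form a convex combination, so bounding each one by [q] suffices. *)
rewrite -[leRHS]mul1r -(sum_sample_prob (l1_neq0 k)) mulr_suml.
apply: ler_sum => l _; rewrite ler_wpM2l ?sample_prob_ge0//.
have BWl := BO _ k l Bw.
apply: (le_trans (IH _ us BWl)); rewrite -/q.
suff : (w *m (Om l *m Cm k *m Gm k) *m ideal_state s) ord0 ord0 ^+ 2 <= 1.
  by lra.
by rewrite -real_normK ?num_real// exprn_ile1// B1.
Qed.

End Circuit.

(** From 1 + x <= e^x; the 2 in the exponent and the prefactor, at least 1, only enlarge the right
    side. *)
Lemma exp_bound {R : realType} (n N : nat) (Ns : R) : 0 < Ns ->
  Num.sqrt ((1 + Ns^-1) ^+ N - 1) <=
  2 `^ (n%:R / 2) * Num.sqrt (expR (2 * N%:R * Ns^-1) - 1).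
Proof.
move=> Ns0; have Ni0 : 0 <= Ns^-1 by rewrite invr_ge0 ltW.
apply: (@le_trans _ _ (Num.sqrt (expR (2 * N%:R * Ns^-1) - 1))).
  rewrite ler_wsqrtr// lerD2r.
  apply: (@le_trans _ _ (expR Ns^-1 ^+ N)).
    by rewrite lerXn2r ?nnegrE ?expR_ge0 ?addr_ge0 ?expR_ge1Dx.
  by rewrite -expRM_natl ler_expR -mulrA ler_peMl ?mulr_ge0// ler1n.
by rewrite ler_peMl ?sqrtr_ge0// -[leLHS](powRr0 2) ler_powR ?ler1n ?divr_ge0//.
Qed.

(** * Application to quantum circuits *)

Theorem proposition3 (R : realType) (n NG L : nat)
    (G : 'I_NG -> 'M[R[i]]_(2 ^ n))
    (Ch : 'I_NG -> {linear 'M[R[i]]_(2 ^ n) -> 'M[R[i]]_(2 ^ n)})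
    (O : 'I_L -> {linear 'M[R[i]]_(2 ^ n) -> 'M[R[i]]_(2 ^ n)})
    (alpha : 'I_NG -> 'I_L -> R)
    (Mob : 'M[R[i]]_(2 ^ n))
    (Ns : R) (m : 'I_NG -> nat)
    (d : measure_display) (Omega : measurableType d) (P : probability Omega R)
    (X : forall k : 'I_NG, 'I_(m k) -> Omega -> 'I_L)
    (G_unitary : forall k, G k \is unitarymx)
    (Ch_cp : forall k, completely_positive (Ch k))
    (Ch_tp : forall k, trace_preserving (Ch k))
    (Ch_inv : forall k, ptm (Ch k) \in unitmx)
    (O_cp : forall l, completely_positive (O l))
    (O_tni : forall l, trace_nonincreasing (O l))
    (alpha_inv : forall k,
        invmx (ptm (Ch k)) = \sum_(l < L) alpha k l *: ptm (O l))
    (alpha_sum1 : forall k, \sum_(l < L) alpha k l = 1)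
    (Mob_herm : Mob \is hermsymmx)
    (Mob_spec : forall a : R[i], eigenvalue Mob a -> -1 <= a <= 1)
    (Mob_tr0 : \tr Mob = 0)
    (Ns_gt0 : 0 < Ns)
    (m_gt0 : forall k, (0 < m k)%N)
    (m_def : forall k, (m k)%:R = Ns * l1norm (alpha k) ^+ 2)
    (X_rv : forall k i, discrete_rv (X k i))
    (X_law : forall k i, has_law P (X k i) (sample_prob (alpha k)))
    (X_indep : mutually_independent P
        (fun j : {k : 'I_NG & 'I_(m k)} => X (tag j) (tagged j))) :
  (sqrte 'E_P[fun w : Omega =>
       ((protected_result G Ch O alpha Mob (fun k i => X k i w)
         - ideal_result G Mob) ^+ 2)%R]
   <= (2 `^ (n%:R / 2) * Num.sqrt (expR (2 * NG%:R * Ns^-1) - 1))%:E)%E.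
Proof.
pose Gp k := ptm (unitary_conj (G k)).
pose Cp k := ptm (Ch k).
pose Op l := ptm (O l).
pose v0 : 'cV[R]_(4 ^ n) := ptvec (ket0_proj n).
pose w := (ptvec Mob)^T.
have l1_neq0 k : l1norm (alpha k) != 0.
  have : (m k)%:R != 0 :> R by rewrite pnatr_eq0 -lt0n.
  by apply: contra_neq => l0; rewrite m_def l0 expr0n mulr0.
have CK k : (\sum_l alpha k l *: Op l) *m Cp k = 1%:M.
  by rewrite -alpha_inv mulVmx.
have Mh : Mob^t* = Mob.
  have /is_hermitianmxP : Mob \is hermsymmx by [].
  by rewrite expr0 scale1r => <-.
(* Conjugation by [G k], repackaged with the linear structure that [ptm_mul_ptvec] requires. *)
pose Gl k : {linear 'M[R[i]]_(2 ^ n) -> 'M[R[i]]_(2 ^ n)} :=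
  mulmxr ((G k)^t*) \o mulmx (G k).
have Gpos k : positive_tni (Gl k) by exact: unitary_conj_positive_tni.
have Cpos k : positive_tni (Ch k).
  by split=> [A|A _]; [exact: completely_positive_psd|rewrite Ch_tp].
have Opos l : positive_tni (O l).
  by split=> [A|]; [exact: completely_positive_psd|exact: O_tni].
have act (F : {linear 'M[R[i]]_(2 ^ n) -> 'M[R[i]]_(2 ^ n)}) A :
  substate A -> ptm F *m ptvec A = ptvec (F A).
  by move=> [/psdmx_herm Ah _]; exact: ptm_mul_ptvec.
(* The class to be used as [B]: bounded readouts, stable under composition with positive
   trace-nonincreasing maps. *)
pose effect (u : 'rV[R]_(4 ^ n)) :=
  forall A, substate A -> `|(u *m ptvec A) ord0 ord0| <= 1.
have effect_comp (F : {linear 'M[R[i]]_(2 ^ n) -> 'M[R[i]]_(2 ^ n)}) u :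
    positive_tni F -> effect u -> effect (u *m ptm F).
  move=> Fpos u1 A A1; rewrite -mulmxA act//.
  exact/u1/positive_tni_substate.
have ideal_substate s : exists2 A, substate A & ideal_state Gp v0 s = ptvec A.
  elim/last_ind: s => [|s k [A A1 sA]].
    by exists (ket0_proj n) => //; exact: substate_ket0_proj.
  exists (Gl k A); first exact: positive_tni_substate.
  by rewrite /ideal_state foldl_rcons -/(ideal_state _ _ _) sA -act.
have w_effect : effect w.
  move=> A [A0 A1]; rewrite ptvec_dot//; last exact: psdmx_herm.
  rewrite -lecR; apply: le_trans (normc_ge_Re _) _.
  exact: trace_bound.
pose J : finType := {k : 'I_NG & 'I_(m k)}.
pose p (j : J) := sample_prob (alpha (tag j)).
have p0 j l : 0 <= p j l by exact: sample_prob_ge0.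
have p1 j : \sum_l p j l = 1 by exact: sum_sample_prob.
pose rn (x : {ffun J -> 'I_L}) : R :=
  (w *m noisy_state alpha Gp Cp Op v0 (enum 'I_NG) x) ord0 ord0.
pose ri : R := (w *m ideal_state Gp v0 (enum 'I_NG)) ord0 ord0.
have riE : ideal_result G Mob = ri by [].
have rnE om : protected_result G Ch O alpha Mob (fun k i => X k i om) =
    rn [ffun j => X (tag j) (tagged j) om].
  apply: (congr1 (fun f => (w *m foldl f v0 (enum 'I_NG)) ord0 ord0)).
  apply/funext => u; apply/funext => k; rewrite /approx_inverse.
  do 3![congr (_ *m _)]; apply: eq_bigr => l _.
  congr (alpha_tilde _ _ _ *: _).
  by apply/funext => i; rewrite ffunE.
under eq_fun do rewrite rnE riE.
rewrite (expectation_discrete (p := p)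
  (F := fun x => (rn x - ri) ^+ 2) (Y := fun j : J => X (tag j) (tagged j)))//;
  last by move=> x; exact: sqr_ge0.
rewrite lee_fin; apply: le_trans (exp_bound n NG Ns_gt0).
rewrite ler_wsqrtr//.
(* The mean of [rn] is [ri], so the mean-square error is the variance. *)
have -> : prod_expect p (fun x => (rn x - ri) ^+ 2) =
    prod_expect p (fun x => rn x ^+ 2) - ri ^+ 2.
  transitivity (prod_expect p
      (fun x => rn x ^+ 2 + ((- 2 * ri) * rn x + ri ^+ 2))).
    by apply: eq_prod_expect => x; ring.
  rewrite !prod_expectD prod_expectZ prod_expect_cst//.
  rewrite (_ : prod_expect p rn = ri); first by ring.
  by apply: expect_noisy => //; exact: enum_uniq.
rewrite lerBlDl.
rewrite -[X in _ ^+ X - 1](card_ord NG) cardE.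
apply: (expect_noisy_sqr l1_neq0 Ns_gt0 m_def CK (B := effect)).
- by move=> u k; exact: (effect_comp (Gl k)).
- move=> u k l u1; rewrite !mulmxA.
  by apply: (effect_comp (Gl k)) => //; do 2![apply/effect_comp => //].
- by move=> u s u1; have [A A1 ->] := ideal_substate s; exact: u1.
- exact: enum_uniq.
- exact: w_effect.
Qed.
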